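(* Let $\mathbb{F}$ be a field (not necessarily algebraically closed) and let $n\ge 3$ be an integer. Consider the $n\times n$ partial matrix over $\mathbb{F}$ $$\mathcal{A}=\begin{bmatrix} a_{11} & a_{12} & ? & \cdots & ?\\ ? & a_{22} & a_{23} & \ddots & \vdots\\ \vdots & \ddots & \ddots & \ddots & ?\\ ? & \cdots & ? & a_{n-1,n-1} & a_{n-1,n}\\ a_{n1} & ? & \cdots & ? & a_{nn} \end{bmatrix},$$ whose specified entries are exactly $a_{ii}$ ($1\le i\le n$), $a_{i,i+1}$ ($1\le i\le n-1$) and $a_{n1}$. Assume that all specified entries $a_{ij}\in\mathbb{F}$ are nonzero. (1) If $a_{12}a_{23}\cdots a_{n-1,n}a_{n1}\neq a_{11}a_{22}\cdots a_{n-1,n-1}a_{nn}$, then $$1=\operatorname{tmr}(\mathcal{A})<\operatorname{fmr}(\mathcal{A})=\frac{n}{n-1}<\operatorname{mr}(\mathcal{A})=2.$$ (2) Otherwise, i.e. if $a_{12}a_{23}\cdots a_{n-1,n}a_{n1}= a_{11}a_{22}\cdots a_{n-1,n-1}a_{nn}$, then $$\operatorname{tmr}(\mathcal{A})=\operatorname{fmr}(\mathcal{A})=\operatorname{mr}(\mathcal{A})=1.$$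
   Context: A partial matrix over a field $\mathbb{F}$ is an $m\times n$ array $\mathcal{A}$ in which some entries are specified elements of $\mathbb{F}$ and the others are unspecified (denoted $?$). Its pattern of knowns is the set $J\subseteq\{1,\dots,m\}\times\{1,\dots,n\}$ of positions of specified entries. A completion is a matrix over $\mathbb{F}$ obtained by specifying all unspecified entries. The minimal rank $\operatorname{mr}(\mathcal{A})$ is the minimum of $\operatorname{rank} B$ over all completions $B$ of $\mathcal{A}$. The same notions apply to partial block matrices, where an unspecified block may be replaced by any matrix over $\mathbb{F}$ of the appropriate size. For $T\subseteq J$, $\mathcal{A}\mid T$ denotes the partial matrix keeping only the specified entries of $\mathcal{A}$ in positions in $T$ (all other positions are unspecified). A pattern $T$ is triangular if whenever $(i,j)\in T$ and $(k,l)\in T$, then $(i,l)\in T$ or $(k,j)\in T$. A triangular $T\subseteq J$ is a maximal triangular subpattern of $J$ if it is maximal under inclusion among triangular subsets of $J$. The triangular minimal rank is $$\operatorname{tmr}(\mathcal{A})=\max\{\operatorname{mr}(\mathcal{A}\mid T): T\subseteq J \text{ maximal triangular}\}.$$ For $b\in\mathbb{N}$ (positive integers), $\mathcal{A}\otimes I_b$ is the partial block matrix obtained by replacing each specified entry $a_{ij}$ by the block $a_{ij}I_b$ and each unspecified entry by a wholly unspecified $b\times b$ block. The fractional minimal rank is $$\operatorname{fmr}(\mathcal{A})=\inf_{b\in\mathbb{N}}\frac{\operatorname{mr}(\mathcal{A}\otimes I_b)}{b}.$$ *)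

(* Defs.v *)
From mathcomp Require Import all_boot all_order all_algebra.
From mathcomp Require Import boolp classical_sets reals.
From mathcomp.real_closed Require Import mxtens.
Set Implicit Arguments.
Unset Strict Implicit.
Unset Printing Implicit Defensive.
Import Order.TTheory GRing.Theory Num.Theory.
Local Open Scope ring_scope.

(* A partial matrix is a matrix of type 'M[option F]_(m, n), where None stands
   for an unspecified entry. *)

Section PartialMatrix.
Variable F : fieldType.

Section Rectangular.
Variables m n : nat.
Implicit Types (A : 'M[option F]_(m, n)) (B : 'M[F]_(m, n)).
Implicit Types (T J : {set 'I_m * 'I_n}).

Definition knowns A : {set 'I_m * 'I_n} := [set p | isSome (A p.1 p.2)].

Definition completion A B : Prop :=
  forall i j a, A i j = Some a -> B i j = a.

Definition completion_rank A : pred nat :=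
  fun r => `[< exists2 B, completion A B & \rank B = r >].

Lemma completion_rank_ex A : exists r, completion_rank A r.
Proof.
pose B : 'M[F]_(m, n) := \matrix_(i, j) odflt 0 (A i j).
exists (\rank B); apply/asboolP; exists B => // i j a Aij.
by rewrite mxE Aij.
Qed.

Definition mr A : nat := ex_minn (completion_rank_ex A).

Definition restrict A T : 'M[option F]_(m, n) :=
  \matrix_(i, j) if (i, j) \in T then A i j else None.

Definition triangular T : bool :=
  [forall p in T, forall q in T, ((p.1, q.2) \in T) || ((q.1, p.2) \in T)].

Definition maximal_triangular J T : bool :=
  maxset (fun S => (S \subset J) && triangular S) T.

Definition tmr A : nat :=
  \max_(T | maximal_triangular (knowns A) T) mr (restrict A T).

(* The block matrix is flattened with the row and column indexing of the
   Kronecker product of mxtens: mxtens_unindex k is the pair (block index, index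
   inside the block). *)
Definition tens_id A b : 'M[option F]_(m * b, n * b) :=
  \matrix_(k, l)
    omap (fun a => (a%:M : 'M[F]_b) (mxtens_unindex k).2 (mxtens_unindex l).2)
         (A (mxtens_unindex k).1 (mxtens_unindex l).1).

End Rectangular.

Definition fmr (R : realType) m n (A : 'M[option F]_(m, n)) : R :=
  inf [set (mr (tens_id A b))%:R / b%:R | b in [set b : nat | (0 < b)%N]]%classic.

(* ordS is the cyclic successor on 'I_n, so with 0-based indices the second
   condition selects the superdiagonal together with the corner (n - 1, 0).
   Entries of a outside these positions are irrelevant. *)
Definition cycle_pattern n : {set 'I_n * 'I_n} :=
  [set p | (p.2 == p.1) || (p.2 == ordS p.1)].

Definition cycle_pmx n (a : 'M[F]_n) : 'M[option F]_n :=
  restrict (map_mx Some a) (cycle_pattern n).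

End PartialMatrix.

(* Main.v *)
(* After scaling rows and columns, all specified entries are 1 except a_{n1} = c,
   the ratio of the two products.  Factor a completion of A (x) I_b of rank r
   into blocks U_i V_j.  As U_i V_i = U_i V_{i+1} = I_b, the columns of
   V_{i+1} - V_i lie in the kernel of U_i, of dimension r - b, so V_n - V_1 has
   rank at most (n - 1)(r - b); but U_n (V_n - V_1) = (1 - c) I_b has rank b if
   c <> 1, whence n b <= (n - 1) r.  Conversely, for b = n - 1 and r = n the V_i
   can be chosen so that V_{i+1} is V_i with its i-th column changed.  A
   triangular pattern misses some position of the cycle, where the entry can be
   reset so as to get c = 1, in which case a rank one completion exists. *)
Require Import Defs.
From mathcomp Require Import all_boot all_order all_algebra.
From mathcomp Require Import boolp reals.
From mathcomp.real_closed Require Import mxtens.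
From mathcomp Require Import zify ring.
Set Implicit Arguments.
Unset Strict Implicit.
Unset Printing Implicit Defensive.
Import Order.TTheory GRing.Theory Num.Theory.
Local Open Scope ring_scope.

(** * Minimal rank, and factorizations of block completions *)

Section MinimalRank.
Variable F : fieldType.

Lemma mr_le m n (A : 'M[option F]_(m, n)) (B : 'M[F]_(m, n)) :
  completion A B -> (mr A <= \rank B)%N.
Proof.
move=> AB; rewrite /mr; case: ex_minnP => r _; apply.
by apply/asboolP; exists B.
Qed.

Lemma mr_attained m n (A : 'M[option F]_(m, n)) :
  exists2 B : 'M[F]_(m, n), completion A B & \rank B = mr A.
Proof. by rewrite /mr; case: ex_minnP => r /asboolP. Qed.

Definition blk m n b (B : 'M[F]_(m * b, n * b)) i j : 'M[F]_b :=
  \matrix_(s, t) B (mxtens_index (i, s)) (mxtens_index (j, t)).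

Lemma completion_tens_idP m n (A : 'M[option F]_(m, n)) b
    (B : 'M[F]_(m * b, n * b)) :
  completion (tens_id A b) B <-> forall i j x, A i j = Some x -> blk B i j = x%:M.
Proof.
split=> [AB i j x Aij | AB k l x].
  by apply/matrixP => s t; rewrite mxE; apply: AB; rewrite mxE !mxtens_indexK /= Aij.
case: (mxtens_indexP k) => i s; case: (mxtens_indexP l) => j t.
rewrite mxE !mxtens_indexK /=; case Aij: (A i j) => [y|] //= [<-].
by rewrite -(AB _ _ _ Aij) mxE.
Qed.

(** For a minimal completion [B], the product [B *t 1%:M] completes [tens_id A b] and factors
    through dimension [\rank B * b]. *)
Lemma mr_tens_id_le m n (A : 'M[option F]_(m, n)) b : (mr (tens_id A b) <= mr A * b)%N.
Proof.
have [B AB <-] := mr_attained A.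
have tensB : completion (tens_id A b) (B *t (1%:M : 'M[F]_b)).
  apply/completion_tens_idP => i j x Aij.
  by apply/matrixP => s t; rewrite mxE tensmxE (AB _ _ _ Aij) !mxE mulr_natr.
apply: leq_trans (mr_le tensB) _.
rewrite -{1}(mulmx_base B) -[X in _ *t X]mulmx1 -tensmx_mul.
exact: mulmx_max_rank.
Qed.

Definition rowblk m b r (U : 'M[F]_(m * b, r)) i : 'M[F]_(b, r) :=
  \matrix_(s, l) U (mxtens_index (i, s)) l.

Definition colblk n b r (V : 'M[F]_(r, n * b)) j : 'M[F]_(r, b) :=
  \matrix_(l, t) V l (mxtens_index (j, t)).

Lemma blk_mul m n b r (U : 'M[F]_(m * b, r)) (V : 'M[F]_(r, n * b)) i j :
  blk (U *m V) i j = rowblk U i *m colblk V j.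
Proof. by apply/matrixP => s t; rewrite !mxE; apply: eq_bigr => l _; rewrite !mxE. Qed.

Lemma tens_id_factor m n (A : 'M[option F]_(m, n)) b :
  exists (U : 'I_m -> 'M[F]_(b, mr (tens_id A b)))
         (V : 'I_n -> 'M[F]_(mr (tens_id A b), b)),
    forall i j x, A i j = Some x -> U i *m V j = x%:M.
Proof.
have [B /completion_tens_idP AB <-] := mr_attained (tens_id A b).
exists (rowblk (col_base B)), (colblk (row_base B)) => i j x Aij.
by rewrite -blk_mul mulmx_base; apply: AB.
Qed.

Lemma mr_tens_id_factor_le m n (A : 'M[option F]_(m, n)) b r
    (U : 'I_m -> 'M[F]_(b, r)) (V : 'I_n -> 'M[F]_(r, b)) :
  (forall i j x, A i j = Some x -> U i *m V j = x%:M) -> (mr (tens_id A b) <= r)%N.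
Proof.
move=> UV.
pose U' : 'M[F]_(m * b, r) :=
  \matrix_(k, l) U (mxtens_unindex k).1 (mxtens_unindex k).2 l.
pose V' : 'M[F]_(r, n * b) :=
  \matrix_(l, k) V (mxtens_unindex k).1 l (mxtens_unindex k).2.
apply: leq_trans (mulmx_max_rank U' V'); apply/mr_le/completion_tens_idP => i j x Aij.
rewrite blk_mul -(UV _ _ _ Aij).
by congr (_ *m _); apply/matrixP => s t; rewrite !mxE mxtens_indexK.
Qed.

Lemma leq_mr_tens_id m n (A : 'M[option F]_(m, n)) b i j x :
  A i j = Some x -> x != 0 -> (b <= mr (tens_id A b))%N.
Proof.
move=> Aij x0; have [U [V UV]] := tens_id_factor A b.
have := UV _ _ _ Aij.
(* The inserted identity has size [mr (tens_id A b)]; a product through it equal to the identity of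
   size [b] bounds its rank below by [b]. *)
rewrite -[U i]mulmx1 => /(congr1 (fun M => x^-1 *: M)).
rewrite scale_scalar_mx mulVf // scalemxAl scalemxAl => /mulmx1_min_rank.
by rewrite mxrank1.
Qed.

Lemma mr_gt0 m n (A : 'M[option F]_(m, n)) i j x :
  A i j = Some x -> x != 0 -> (0 < mr A)%N.
Proof.
move=> Aij x0; rewrite -[mr A]muln1.
exact: leq_trans (leq_mr_tens_id 1 Aij x0) (mr_tens_id_le A 1).
Qed.

End MinimalRank.

(** * Lower bound for factorizations of a normalized cycle of size [n.+1] *)

Section Cycle.
Variables (F : fieldType) (n : nat).
Implicit Types a : 'M[F]_n.+1.

Lemma cycle_factor_bound b r (U : 'I_n.+1 -> 'M[F]_(b, r))
    (V : 'I_n.+1 -> 'M[F]_(r, b)) (c : F) :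
  c != 1 ->
  (forall i, U i *m V i = 1%:M) ->
  (forall i, i != ord_max -> U i *m V (ordS i) = 1%:M) ->
  U ord_max *m V ord0 = c%:M ->
  (n.+1 * b <= n * r)%N.
Proof.
move=> c1 UV UVS UVc.
have rankU i : \rank (U i) = b.
  apply/eqP; rewrite eqn_leq rank_leq_row /=.
  by apply: (@mulmx1_min_rank _ _ _ _ _ 1%:M (V i)); rewrite mul1mx.
have b_le_r : (b <= r)%N by rewrite -(rankU ord0) rank_leq_col.
have rankV k : (k <= n)%N -> (\rank (V (inord k) - V ord0)%R <= k * (r - b))%N.
  elim: k => [|k IHk] lekn.
    by rewrite (_ : inord 0 = ord0 :> 'I_n.+1) ?subrr ?mxrank0 //; apply/val_inj; rewrite /= inordK.
  have SkE : inord k.+1 = ordS (inord k : 'I_n.+1).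
    by apply/val_inj; rewrite /= !inordK ?modn_small //; lia.
  have -> : V (inord k.+1) - V ord0 =
      (V (inord k.+1) - V (inord k)) + (V (inord k) - V ord0) by rewrite subrKA.
  apply: leq_trans (mxrank_add _ _) _; rewrite mulSn; apply: leq_add; last by apply: IHk; lia.
  have /mulmx0_rank_max : U (inord k) *m (V (inord k.+1) - V (inord k)) = 0.
    rewrite mulmxBr UV SkE UVS ?subrr //.
    by apply/eqP => /(congr1 val); rewrite /= inordK; lia.
  by rewrite rankU; lia.
(* Thanks to [b_le_r] the truncated subtraction is exact, so this is the goal rearranged. *)
suff : (b <= n * (r - b))%N by nia.
apply: leq_trans (rankV n _) => //.
rewrite (_ : inord n = ord_max :> 'I_n.+1); last by apply/val_inj; rewrite /= inordK.
(* The scaled [U ord_max] is a left inverse of [V ord_max - V ord0], which therefore has rank at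
   least [b]. *)
apply: (@mulmx1_min_rank _ _ _ _ _ ((1 - c)^-1 *: U ord_max) 1%:M).
rewrite mulmx1 -scalemxAl mulmxBr UV UVc -(raddfB (@scalar_mx F b)) scale_scalar_mx mulVf //.
by rewrite subr_eq0 eq_sym.
Qed.

(** * Normalization by row and column scalings *)

Definition cycle_nz a := forall i j, (i, j) \in cycle_pattern n.+1 -> a i j != 0.

Definition cycle_ratio a : F := (\prod_i a i (ordS i)) / \prod_i a i i.

Lemma diag_cycle i : (i, i) \in cycle_pattern n.+1.
Proof. by rewrite inE eqxx. Qed.

Lemma superdiag_cycle i : (i, ordS i) \in cycle_pattern n.+1.
Proof. by rewrite inE eqxx orbT. Qed.

Lemma cycle_pmx_diag a i : cycle_pmx a i i = Some (a i i).
Proof. by rewrite mxE diag_cycle mxE. Qed.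

Lemma cycle_pmx_superdiag a i : cycle_pmx a i (ordS i) = Some (a i (ordS i)).
Proof. by rewrite mxE superdiag_cycle mxE. Qed.

Lemma cycle_pmx_ind a (P : 'I_n.+1 -> 'I_n.+1 -> F -> Prop) :
  (forall i, P i i (a i i)) -> (forall i, P i (ordS i) (a i (ordS i))) ->
  forall i j x, cycle_pmx a i j = Some x -> P i j x.
Proof.
move=> Pd Ps i j x; rewrite mxE; case: ifP => //; rewrite mxE inE /=.
by move=> /orP[] /eqP-> [<-].
Qed.

Lemma ordS_max : ordS (ord_max : 'I_n.+1) = ord0.
Proof. by apply/val_inj; rewrite /= modnn. Qed.

Lemma ordS_neq_max (i : 'I_n.+1) : i != ord_max -> ordS i = i.+1 :> nat.
Proof. by move=> im; rewrite /= modn_small // ltnS ltn_neqAle im -ltnS ltn_ord. Qed.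

Lemma cycle_nz_ratio a : cycle_nz a -> cycle_ratio a != 0.
Proof.
move=> a0; rewrite mulf_neq0 ?invr_eq0 //; apply/prodf_neq0 => i _; apply: a0.
  exact: superdiag_cycle.
exact: diag_cycle.
Qed.

Lemma cycle_ratio_eq1 a : cycle_nz a ->
  (cycle_ratio a == 1) = (\prod_i a i (ordS i) == \prod_i a i i).
Proof.
move=> a0.
have d0 : \prod_i a i i != 0 by apply/prodf_neq0 => i _; apply/a0/diag_cycle.
by rewrite /cycle_ratio -[X in _ == X](divff d0) (inj_eq (mulIf (invr_neq0 d0))).
Qed.

(** Let [q] be the running product of the quotients [t], and choose [p] to fit the diagonal. The
    superdiagonal then fits too, and the discrepancy after one turn around the cycle is left at the
    corner. *)
Lemma cycle_normal_form a : cycle_nz a ->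
  exists p q : 'I_n.+1 -> F,
    [/\ forall i, p i != 0, forall i, q i != 0, forall i, a i i = p i * q i,
        forall i, i != ord_max -> a i (ordS i) = p i * q (ordS i)
      & a ord_max ord0 = p ord_max * q ord0 * cycle_ratio a].
Proof.
move=> a0; pose t i := a i (ordS i) / a i i.
pose q (l : 'I_n.+1) := \prod_(k < n.+1 | (k < l)%N) t k.
have d0 i : a i i != 0 by apply/a0/diag_cycle.
have q0 l : q l != 0.
  apply/prodf_neq0 => k _; rewrite mulf_neq0 ?invr_eq0 //.
  exact/a0/superdiag_cycle.
exists (fun i => a i i / q i), q; split=> // [i|i|i im|].
- by rewrite mulf_neq0 ?invr_eq0.
- by rewrite divfK.
- have -> : q (ordS i) = t i * q i.
    rewrite /q ordS_neq_max // (bigD1 i) //=; congr (_ * _).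
    by apply: eq_bigl => k; rewrite -val_eqE /=; lia.
  by rewrite /t; field; rewrite q0 d0.
- have -> : q ord0 = 1 by apply: big_pred0 => k; rewrite ltn0.
  have -> : cycle_ratio a = t ord_max * q ord_max.
    rewrite /cycle_ratio -prodf_div (bigD1 ord_max) //=; congr (_ * _).
    by apply: eq_bigl => k; rewrite -val_eqE /=; have := ltn_ord k; lia.
  by rewrite /t ordS_max; field; rewrite q0 d0.
Qed.

(** * Rank bounds for the cycle and its block versions *)

(** The rank one matrix with entries [p i * q j] fits every specified entry except possibly the
    corner; correcting the corner adds rank at most one, and none if the ratio is 1. The hypothesis
    [0 < n] keeps the corner off the diagonal. *)
Lemma mr_cycle_le a : (0 < n)%N -> cycle_nz a ->
  (mr (cycle_pmx a) <= (cycle_ratio a != 1%R).+1)%N.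
Proof.
move=> n0 a0; have [p [q [p0 q0 ad aS ac]]] := cycle_normal_form a0.
pose x := p ord_max * q ord0 * (cycle_ratio a - 1).
pose B := (\col_i p i) *m (\row_j q j) + x *: delta_mx ord_max ord0.
have BE i j : B i j = p i * q j + x * ((i == ord_max) && (j == ord0))%:R.
  by rewrite !mxE big_ord1 !mxE.
have AB : completion (cycle_pmx a) B.
  apply: cycle_pmx_ind => i.
    rewrite BE ad; case: eqP => [->|_]; last by rewrite mulr0 addr0.
    by rewrite -val_eqE /= (gtn_eqF n0) mulr0 addr0.
  rewrite BE; have [->|im] := eqVneq i ord_max.
    by rewrite ordS_max !eqxx /= ac /x; ring.
  by rewrite mulr0 addr0 aS.
apply: leq_trans (mr_le AB) _; apply: leq_trans (mxrank_add _ _) _.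
rewrite -[leqRHS]add1n leq_add ?mulmx_max_rank //.
have [c1|_] /= := eqVneq; first by rewrite /x c1 subrr mulr0 scale0r mxrank0.
by apply: leq_trans (mxrank_scale _ _) _; rewrite mxrank_delta.
Qed.

Lemma mr_tens_id_cycle_ge a b : cycle_nz a -> cycle_ratio a != 1 ->
  (n.+1 * b <= n * mr (tens_id (cycle_pmx a) b))%N.
Proof.
move=> a0 c1; have [p [q [p0 q0 ad aS ac]]] := cycle_normal_form a0.
have [U [V UV]] := tens_id_factor (cycle_pmx a) b.
apply: (@cycle_factor_bound _ _ (fun i => (p i)^-1 *: U i) (fun j => (q j)^-1 *: V j) _ c1).
- move=> i; rewrite -scalemxAl -scalemxAr (UV _ _ _ (cycle_pmx_diag a i)) !scale_scalar_mx ad.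
  by congr _%:M; field; rewrite p0 q0.
- move=> i im; rewrite -scalemxAl -scalemxAr (UV _ _ _ (cycle_pmx_superdiag a i)).
  rewrite !scale_scalar_mx aS //.
  by congr _%:M; field; rewrite p0 q0.
- have /UV := cycle_pmx_superdiag a ord_max; rewrite ordS_max => UVm.
  rewrite -scalemxAl -scalemxAr UVm !scale_scalar_mx ac.
  by congr _%:M; field; rewrite p0 q0.
Qed.

(* Column k of V l is e_k for l <= k and (e_k + e_n) / c for k < l.  The rows of
   U i are the functionals dual to the columns of V i, corrected in row i by a
   multiple of the functional x_n - \sum_(k < i) x_k killing all these columns,
   so that U i is dual to V (i + 1) as well. *)
Lemma cycle_factor_exists (c : F) : c != 0 ->
  exists (U : 'I_n.+1 -> 'M[F]_(n, n + 1)) (V : 'I_n.+1 -> 'M[F]_(n + 1, n)),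
    [/\ forall i, U i *m V i = 1%:M,
        forall i, i != ord_max -> U i *m V (ordS i) = 1%:M
      & U ord_max *m V ord0 = c%:M].
Proof.
move=> c0.
pose U (i : 'I_n.+1) : 'M[F]_(n, n + 1) :=
  row_mx (\matrix_(j < n, k < n) ((j == k)%:R * (if (j < i)%N then c else 1)
                                  + ((j == i :> nat) && (k < i)%N)%:R * (1 - c)))
         (\col_(j < n) (- (j == i :> nat)%:R * (1 - c))).
pose V (l : 'I_n.+1) : 'M[F]_(n + 1, n) :=
  col_mx (diag_mx (\row_k (if (k < l)%N then c^-1 else 1)))
         (\row_k (if (k < l)%N then c^-1 else 0)).
have UVE i l (j k : 'I_n) : (U i *m V l) j k =
    ((j == k)%:R * (if (j < i)%N then c else 1)
      + ((j == i :> nat) && (k < i)%N)%:R * (1 - c)) * (if (k < l)%N then c^-1 else 1)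
    - (j == i :> nat)%:R * (1 - c) * (if (k < l)%N then c^-1 else 0).
  by rewrite mul_row_col mul_mx_diag !mxE big_ord1 !mxE !mulNr.
exists U, V; split=> [i|i im|]; apply/matrixP => j k; rewrite UVE mxE.
- rewrite -val_eqE /=; have [ki|ik] := ltnP k i; last first.
    by rewrite andbF; have [->|_] := eqVneq (j : nat) k; rewrite ?(leq_gtF ik) /=; ring.
  have [->|_] := eqVneq (j : nat) k; first by rewrite ?ki; case: (k == i :> nat) => /=; field.
  by case: (j == i :> nat) => /=; field.
- rewrite (ordS_neq_max im) ltnS -val_eqE /=.
  (* Column [k = i] is the only one in which [V (ordS i)] differs from [V i]. *)
  have [ki|ik|<-] := ltngtP k i.
  + have [->|_] := eqVneq (j : nat) k; first by rewrite ?ki; case: (k == i :> nat) => /=; field.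
    by case: (j == i :> nat) => /=; field.
  + by rewrite andbF; have [->|_] := eqVneq (j : nat) k;
      rewrite ?(ltn_geF ik) ?(leq_gtF (ltnW ik)) /=; ring.
  + by rewrite andbF; have [->|_] := eqVneq (j : nat) k; rewrite ?ltnn /=; field.
(* No row index [j] equals [n], so [U ord_max] is [c] times the identity followed by a zero column,
   while [V ord0] is the identity above a zero row. *)
- by rewrite -val_eqE /= !ltn_ord (ltn_eqF (ltn_ord j)) mulr_natl /=; ring.
Qed.

Lemma mr_tens_id_cycle_le a : cycle_nz a ->
  (mr (tens_id (cycle_pmx a) n) <= n.+1)%N.
Proof.
move=> a0; have [p [q [p0 q0 ad aS ac]]] := cycle_normal_form a0.
have [U [V [UV UVS UVc]]] := cycle_factor_exists (cycle_nz_ratio a0).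
rewrite -[leqRHS]addn1.
apply: (@mr_tens_id_factor_le _ _ _ _ _ _ (fun i => p i *: U i) (fun j => q j *: V j)).
apply: cycle_pmx_ind => i; rewrite -scalemxAl -scalemxAr.
  by rewrite UV !scale_scalar_mx ad mulr1.
have [->|im] := eqVneq i ord_max.
  by rewrite ordS_max UVc !scale_scalar_mx ac mulrA.
by rewrite UVS // !scale_scalar_mx aS // mulr1.
Qed.

(** * Triangular subpatterns of the cycle *)

(** The positions (0, 0) and (1, 2) violate the condition: for size at least 3, neither (0, 2) nor
    (1, 0) lies on the cycle. *)
Lemma cycle_not_triangular : (1 < n)%N -> ~~ triangular (cycle_pattern n.+1).
Proof.
move=> n1; apply/negP => /forall_inP/(_ _ (diag_cycle ord0))/forall_inP.
move=> /(_ _ (superdiag_cycle (inord 1))).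
rewrite !inE /= -!val_eqE /= inordK ?ltnS ?(ltnW n1) // !modn_small //; lia.
Qed.

(** The two cyclic diagonals are disjoint, so the entry at [e] occurs in just one of the two
    products. It is multiplied by the ratio when it is in the denominator, by the inverse ratio when
    it is in the numerator. *)
Lemma cycle_ratio_adjust a e : (0 < n)%N -> cycle_nz a -> e \in cycle_pattern n.+1 ->
  exists a', [/\ cycle_nz a', cycle_ratio a' = 1
    & forall i j, (i, j) \in cycle_pattern n.+1 -> (i, j) != e -> a' i j = a i j].
Proof.
case: e => i j n0 a0 eJ.
have ordS_neq k : (ordS k == k :> 'I_n.+1) = false.
  apply/negbTE; have [->|km] := eqVneq k ord_max.
    by rewrite ordS_max -val_eqE /=; lia.
  by apply/eqP => /(congr1 (@nat_of_ord _)); rewrite ordS_neq_max //; lia.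
have r0 := cycle_nz_ratio a0.
pose a' : 'M[F]_n.+1 := \matrix_(k, l) (a k l *
  (if (k, l) == (i, j) then if j == i then cycle_ratio a else (cycle_ratio a)^-1 else 1)).
exists a'; split.
- move=> k l klJ; rewrite mxE mulf_neq0 ?a0 //.
  by case: ifP => _; rewrite ?oner_eq0 //; case: ifP; rewrite ?invr_eq0.
- have d0 : \prod_k a k k != 0 by apply/prodf_neq0 => k _; apply/a0/diag_cycle.
  have s0 : \prod_k a k (ordS k) != 0.
    by apply/prodf_neq0 => k _; apply/a0/superdiag_cycle.
  rewrite /cycle_ratio; under eq_bigr do rewrite mxE.
  under [X in _ / X]eq_bigr do rewrite mxE.
  rewrite !big_split /=; move: eJ; rewrite inE /= => /orP[] /eqP->.
    rewrite eqxx [X in _ * X / _]big1 => [|k _]; last first.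
      by rewrite xpair_eqE; case: eqP => //= ->; rewrite ordS_neq.
    rewrite [X in _ / (_ * X)](bigD1 i) //= eqxx
      [X in _ / (_ * (_ * X))]big1 => [|k /negPf ki]; last first.
        by rewrite xpair_eqE ki.
    by rewrite /cycle_ratio; field; rewrite d0 s0.
  rewrite ordS_neq [X in _ * X / _](bigD1 i) //= eqxx
    [X in _ * (_ * X) / _]big1 => [|k /negPf ki]; last first.
      by rewrite xpair_eqE ki.
  rewrite [X in _ / (_ * X)]big1 => [|k _]; last first.
    by rewrite xpair_eqE; case: eqP => //= ->; rewrite eq_sym ordS_neq.
  by rewrite /cycle_ratio; field; rewrite d0 s0.
- by move=> k l _ /negPf ne; rewrite mxE ne mulr1.
Qed.

Lemma knowns_cycle_pmx a : knowns (cycle_pmx a) = cycle_pattern n.+1.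
Proof. by apply/setP => -[i j]; rewrite inE mxE /=; case: ifP => //; rewrite mxE. Qed.

Lemma tmr_cycle a : (1 < n)%N -> cycle_nz a -> tmr (cycle_pmx a) = 1%N.
Proof.
move=> n1 a0; apply/eqP; rewrite /tmr knowns_cycle_pmx eqn_leq; apply/andP; split.
  apply/bigmax_leqP => T /maxsetp /andP[TJ Ttri].
  have /subsetPn[e eJ eT] : ~~ (cycle_pattern n.+1 \subset T).
    apply: contra (cycle_not_triangular n1) => JT.
    by have /eqP<- : T == cycle_pattern n.+1 by rewrite eqEsubset TJ JT.
  have [a' [a'0 c1 aa']] := cycle_ratio_adjust (ltnW n1) a0 eJ.
  have := mr_cycle_le (ltnW n1) a'0; rewrite c1 eqxx; apply: leq_trans.
  (* As [e] lies outside [T], [a'] agrees with [a] on [T], and a completion for [a'] also completes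
     the restriction. *)
  have [B AB <-] := mr_attained (cycle_pmx a'); apply: mr_le => i j x.
  rewrite mxE; case: ifP => // ijT; have ijJ := subsetP TJ _ ijT.
  rewrite mxE ijJ mxE => -[<-]; apply: AB.
  rewrite mxE ijJ mxE aa' //; by apply: contraNneq eT => <-.
(* An empty maximum would be 0, so a maximal triangular pattern is produced by extending a
   singleton; its nonzero entry forces positive rank. *)
have tri1 : [set (ord0 : 'I_n.+1, ord0 : 'I_n.+1)] \subset cycle_pattern n.+1
    /\ triangular [set (ord0 : 'I_n.+1, ord0 : 'I_n.+1)].
  rewrite sub1set diag_cycle; split=> //.
  by apply/forall_inP => p /set1P->; apply/forall_inP => q /set1P->; rewrite inE eqxx.
have [T maxT subT] := maxset_exists (P := fun S => (S \subset cycle_pattern n.+1) && triangular S)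
  (introT andP tri1).
apply: leq_trans (leq_bigmax_cond _ maxT).
apply: (@mr_gt0 _ _ _ _ ord0 ord0 (a ord0 ord0)); last exact/a0/diag_cycle.
by rewrite mxE (subsetP subT) ?inE // cycle_pmx_diag.
Qed.

End Cycle.

(** * Fractional minimal rank and conclusion *)

(** A lower bound reached at some [b] is the infimum; [x] witnesses boundedness below and [b]
    nonemptiness, both required for [inf] over the reals. *)
Lemma fmr_eq (R : realType) (F : fieldType) m n (A : 'M[option F]_(m, n)) (x : R) b :
  (0 < b)%N -> (forall d, (0 < d)%N -> x <= (mr (tens_id A d))%:R / d%:R) ->
  (mr (tens_id A b))%:R / b%:R <= x -> fmr R A = x.
Proof.
move=> b0 lb xb; apply/eqP; rewrite eq_le; apply/andP; split.
  apply: le_trans xb; apply: ge_inf; last by exists b.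
  by exists x => _ [d d0 <-]; apply: lb.
apply: lb_le_inf; first by exists ((mr (tens_id A b))%:R / b%:R), b.
by move=> _ [d d0 <-]; apply: lb.
Qed.

Theorem theorem3p1 (R : realType) (F : fieldType) (n : nat) (a : 'M[F]_n)
    (n_ge3 : (3 <= n)%N)
    (a_neq0 : forall i j, (i, j) \in cycle_pattern n -> a i j != 0) :
  (\prod_(i < n) a i (ordS i) <> \prod_(i < n) a i i ->
     [/\ tmr (cycle_pmx a) = 1%N,
         (tmr (cycle_pmx a))%:R < fmr R (cycle_pmx a),
         fmr R (cycle_pmx a) = n%:R / (n%:R - 1),
         fmr R (cycle_pmx a) < (mr (cycle_pmx a))%:R
       & mr (cycle_pmx a) = 2%N])
  /\
  (\prod_(i < n) a i (ordS i) = \prod_(i < n) a i i ->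
     [/\ tmr (cycle_pmx a) = 1%N,
         fmr R (cycle_pmx a) = 1
       & mr (cycle_pmx a) = 1%N]).
Proof.
case: n n_ge3 a a_neq0 => [//|n]; rewrite ltnS => n1 a a0.
have n0 := ltnW n1; have tmr1 := tmr_cycle n1 a0; rewrite tmr1.
have ubA := mr_cycle_le n0 a0.
have nR : (1 : R) < n%:R by rewrite ltr1n.
have nSR : n.+1%:R - 1 = n%:R :> R by rewrite -natr1 addrK.
have n0R : (0 : R) < n%:R by rewrite ltr0n.
split=> [/eqP|/eqP]; rewrite -(cycle_ratio_eq1 a0) => c1; rewrite ?c1 in ubA.
  have lb := mr_tens_id_cycle_ge _ a0 c1.
  have mr2 : mr (cycle_pmx a) = 2%N.
    (* Block size 1 gives [n.+1 <= n * mr (cycle_pmx a)], which excludes rank at most 1. *)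
    have := leq_trans (lb 1%N) (leq_mul (leqnn n) (mr_tens_id_le _ 1)).
    by move: ubA => /=; nia.
  have fmrE : fmr R (cycle_pmx a) = n.+1%:R / (n.+1%:R - 1).
    (* The infimum is attained at block size [n], one less than the size of the matrix. *)
    rewrite nSR; apply: (@fmr_eq _ _ _ _ _ _ n) => // [d d0|].
      rewrite ler_pdivrMr // mulrAC ler_pdivlMr ?ltr0n // -!natrM ler_nat.
      by rewrite [leqRHS]mulnC; apply: lb.
    by rewrite ler_pM2r ?invr_gt0 // ler_nat mr_tens_id_cycle_le.
  split=> //; rewrite fmrE nSR ?mr2.
    by rewrite ltr_pdivlMr // mul1r ltr_nat.
  by rewrite ltr_pdivrMr // -natrM ltr_nat; lia.
have Ad := cycle_pmx_diag a ord0; have d0 := a0 _ _ (diag_cycle ord0).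
have mr1 : mr (cycle_pmx a) = 1%N.
  by apply/eqP; rewrite eqn_leq ubA (mr_gt0 Ad d0).
(* Here block size 1 is already optimal: one nonzero specified entry bounds every quotient below by
   1. *)
split=> //; apply: (@fmr_eq _ _ _ _ _ _ 1) => // [d dpos|].
  by rewrite ler_pdivlMr ?ltr0n // mul1r ler_nat (leq_mr_tens_id _ Ad d0).
by rewrite divr1 lern1 -[leqRHS]mr1 -[leqRHS]muln1 mr_tens_id_le.
Qed.
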